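(* The triple $(K[\mathcal{T}_\infty],*,\Delta)$, with unit $\odot$ and counit $\epsilon$, is a Hopf algebra; in particular $\Delta(u* v)=\Delta(u)*\Delta(v)$ for all trees $u,v$, where $*$ acts componentwise on $K[\mathcal{T}_\infty]\otimes K[\mathcal{T}_\infty]$.
   Context: $K$ is a field. A tree is a finite planar rooted tree; degree $|t|$ = number of non-root nodes; $\odot$ the one-node tree; $\mathcal{T}_\infty$ the set of trees; $K[\mathcal{T}_\infty]$ the vector space with basis $\mathcal{T}_\infty$, graded by degree. Nodes $N(t)$ are ordered by depth-first post-order (subtrees left to right recursively, then the node; root maximal); write $u_1<\dots<u_n$ for the non-root nodes. For a set $A$ of non-root nodes, $t_A$ is obtained by deleting non-root nodes outside $A$ (children of a deleted node attached in order to its parent in its place); $t_{[i,j]}=t_{\{u_h,\dots,u_k\}}$ if $i\le j$ and $[i,j]\cap[n]=[h,k]\ne\emptyset$, else $\odot$. Coproduct: $\Delta(t)=\sum_{k=0}^{n}t_{[1,k]}\otimes t_{[k+1,n]}$ for $|t|=n$; counit $\epsilon(t)=1$ if $|t|=0$, else $0$. A partition of $u$ of degree $n\ge1$ is an ordered tuple $(u_{[n_0+1,n_1]},\dots,u_{[n_{k-1}+1,n_k]})$ with $0=n_0<\dots<n_k=n$; $\mathcal{P}(u)$ the set of partitions. For $P=(u_1,\dots,u_k)$, $I(P,t)$ is the set of maps $f$ from blocks to $N(t)$ with $f(u_1)<\dots<f(u_k)$. The hash product $t\#_{P,f}u$ is obtained by identifying the root of each $u_i$ with $f(u_i)$, the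 root-children of $u_i$ becoming children of $f(u_i)$ to the right of its original children. The product $*$ is the bilinear extension of $t* u=\sum_{P\in\mathcal{P}(u)}\sum_{f\in I(P,t)}t\#_{P,f}u$ ($|u|\ge1$), $t*\odot=t$. *)

(* Defs.v *)
From HB Require Import structures.
From mathcomp Require Import all_boot all_order all_algebra.
Set Implicit Arguments. Unset Strict Implicit. Unset Printing Implicit Defensive.
Import GRing.Theory.
Local Open Scope ring_scope.

Inductive tree := Node of seq tree.

Definition odot : tree := Node [::].

Definition children (t : tree) : seq tree := let: Node cs := t in cs.

Fixpoint enc (t : tree) : GenTree.tree unit :=
  let: Node cs := t in GenTree.Node 0 (map enc cs).
Fixpoint dec (g : GenTree.tree unit) : tree :=
  match g with GenTree.Leaf _ => Node [::] | GenTree.Node _ gs => Node (map dec gs) end.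
Lemma encK : cancel enc dec.
Proof.
rewrite /cancel; fix IH 1 => -[cs] /=; congr Node; elim: cs => //= c cs IHcs; by rewrite IH IHcs.
Qed.
HB.instance Definition _ := Equality.copy tree (can_type encK).

Fixpoint tsize (t : tree) : nat := let: Node cs := t in (sumn (map tsize cs)).+1.

Definition deg (t : tree) : nat := (tsize t).-1.

(* Nodes of a tree t are numbered 0, 1, ..., |t| in depth-first post-order
   (subtrees left to right recursively, then the node); the root is |t|.
   The non-root node u_i of the paper (1 <= i <= |t|) has number i-1. *)

(** [restr keep c]: forest obtained from the full subtree c, whose nodes are
    numbered 0 .. tsize c - 1 in post-order, by deleting the nodes x with
    ~~ keep x (children of a deleted node take its place, in order). *)
Fixpoint restr (keep : nat -> bool) (t : tree) : seq tree :=
  let: Node cs := t in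
  let fix go (keep : nat -> bool) (cs : seq tree) : seq tree :=
    match cs with
    | [::] => [::]
    | c :: cs' => restr keep c ++ go (fun i => keep (i + tsize c)) cs'
    end in
  let F := go keep cs in
  if keep (tsize t).-1 then [:: Node F] else F.

Fixpoint frestr (keep : nat -> bool) (cs : seq tree) : seq tree :=
  match cs with
  | [::] => [::]
  | c :: cs' => restr keep c ++ frestr (fun i => keep (i + tsize c)) cs'
  end.

Definition restrict (keep : nat -> bool) (t : tree) : tree :=
  Node (frestr keep (children t)).

(** t_{[i,j]} (1-based, as in the paper): keep u_h with i <= h <= j.
    When [i,j] ∩ [n] is empty this yields ⊙, as required. *)
Definition tint (i j : nat) (t : tree) : tree :=
  restrict (fun x => (i <= x.+1 <= j)%N) t.

(** [graft g t]: add to every node x of t (post-order number) the trees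
    [g x] as new children, to the right of its original children. *)
Fixpoint graft (g : nat -> seq tree) (t : tree) : tree :=
  let: Node cs := t in
  let fix go (g : nat -> seq tree) (cs : seq tree) : seq tree :=
    match cs with
    | [::] => [::]
    | c :: cs' => graft g c :: go (fun i => g (i + tsize c)) cs'
    end in
  Node (go g cs ++ g (tsize t).-1).

Fixpoint bseqs (n : nat) : seq (seq bool) :=
  if n is n'.+1 then [seq b :: s | b <- [:: true; false], s <- bseqs n'] else [:: [::]].

(** all strictly increasing sequences 0 = n_0 < n_1 < ... < n_k = n  (n >= 1) *)
Definition cutseqs (n : nat) : seq (seq nat) :=
  [seq 0%N :: rcons (mask m (iota 1 n.-1)) n | m <- bseqs n.-1].

Definition blocks (u : tree) (c : seq nat) : seq tree :=
  [seq tint a.1.+1 a.2 u | a <- zip c (behead c)].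

Definition partitions (u : tree) : seq (seq tree) := [seq blocks u c | c <- cutseqs (deg u)].

(** I(P,t): strictly increasing maps from the k blocks to N(t) = {0..|t|},
    given as the increasing sequence of their values *)
Definition incmaps (k : nat) (t : tree) : seq (seq nat) :=
  [seq mask m (iota 0 (tsize t)) | m <- bseqs (tsize t) & count id m == k].

Definition hash (t : tree) (P : seq tree) (f : seq nat) : tree :=
  graft (fun x => if x \in f then children (nth odot P (index x f)) else [::]) t.

(** t * u on bvec elements, as a list of trees (each with coefficient 1) *)
Definition tstar (t u : tree) : seq tree :=
  if deg u == 0%N then [:: t]
  else flatten [seq [seq hash t P f | f <- incmaps (size P) t] | P <- partitions u].

(** Δ(t) on bvec elements: list of tensors (each with coefficient 1) *)
Definition tcoprod (t : tree) : seq (tree * tree) :=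
  [seq (tint 1 k t, tint k.+1 (deg t) t) | k <- iota 0 (deg t).+1].

Section Formal.
Variable K : fieldType.

(** an element of K[T] is represented by a finite formal sum *)
Definition fsum (T : Type) := seq (K * T).

(** the coefficient of a bvec element; two formal sums denote the same
    vector iff their coefficient functions agree *)
Definition fcoef (T : eqType) (x : fsum T) (t : T) : K :=
  \sum_(p <- x | p.2 == t) p.1.

Definition veq (T : eqType) (x y : fsum T) : Prop := forall t, fcoef x t = fcoef y t.

Definition bvec (T : Type) (t : T) : fsum T := [:: (1, t)].

Definition flin (T U : Type) (f : T -> fsum U) (x : fsum T) : fsum U :=
  flatten [seq [seq (p.1 * q.1, q.2) | q <- f p.2] | p <- x].

Definition bilin (T U V : Type) (f : T -> U -> fsum V) (x : fsum T) (y : fsum U)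
  : fsum V :=
  flatten [seq [seq (p.1 * q.1 * r.1, r.2) | r <- f p.2 q.2] | p <- x, q <- y].

Definition ones (T : Type) (s : seq T) : fsum T := [seq (1, a) | a <- s].

Definition hmul : fsum tree -> fsum tree -> fsum tree :=
  bilin (fun t u => ones (tstar t u)).

Definition hmul2 : fsum (tree * tree) -> fsum (tree * tree) -> fsum (tree * tree) :=
  bilin (fun ab cd => [seq (r.1 * s.1, (r.2, s.2))
                        | r <- ones (tstar ab.1 cd.1), s <- ones (tstar ab.2 cd.2)]).

Definition coprod : fsum tree -> fsum (tree * tree) := flin (fun t => ones (tcoprod t)).

Definition eps_t (t : tree) : K := if deg t == 0%N then 1 else 0.
Definition eps (x : fsum tree) : K := \sum_(p <- x) p.1 * eps_t p.2.

Definition coprod_l : fsum (tree * tree) -> fsum ((tree * tree) * tree) :=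
  flin (fun ab => [seq (q.1, (q.2, ab.2)) | q <- ones (tcoprod ab.1)]).
Definition coprod_r : fsum (tree * tree) -> fsum ((tree * tree) * tree) :=
  flin (fun ab => [seq (q.1, ((ab.1, q.2.1), q.2.2)) | q <- ones (tcoprod ab.2)]).

Definition eps_l : fsum (tree * tree) -> fsum tree :=
  flin (fun ab => [:: (eps_t ab.1, ab.2)]).
Definition eps_r : fsum (tree * tree) -> fsum tree :=
  flin (fun ab => [:: (eps_t ab.2, ab.1)]).

Definition conv_l (S : tree -> fsum tree) : fsum (tree * tree) -> fsum tree :=
  flin (fun ab => hmul (S ab.1) (bvec ab.2)).
Definition conv_r (S : tree -> fsum tree) : fsum (tree * tree) -> fsum tree :=
  flin (fun ab => hmul (bvec ab.1) (S ab.2)).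

Definition unitv (k : K) : fsum tree := [:: (k, odot)].

End Formal.

(* Main.v *)
(* A tree is identified with the forest of its root-subtrees, and forests are
   handled as binary trees Node cs :: F (forest_ind). The coproduct fcop then
   satisfies  Delta(cs' F) = sum cs_1 (x) (cs_2)' F + sum cs' F_1 (x) F_2, where
   cs' is cs with a root added; coassociativity and the counit laws follow by
   induction. A partition of u with an increasing map to the nodes of t is the
   same as a way of cutting u into |t|+1 possibly empty consecutive intervals,
   one per node of t, so t * u is a graft along the iterated coproduct of u.
   Hence the product (starT) obeys a recursion on t in which u enters only
   through its coproduct, and Delta(t * u) = Delta(t) * Delta(u), then
   associativity, follow by induction on t. Equality of formal sums is tested by
   pairing with arbitrary functions on trees, so that every identity becomes one
   between finite sums. The antipode is the recursive right convolution inverse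
   of the identity; computing sum t_1 * S(t_2) * t_3 in two ways shows, by
   induction on the degree, that it is a left inverse too. *)
Require Import Defs.
From HB Require Import structures.
From mathcomp Require Import all_boot all_order all_algebra.
From mathcomp Require Import zify.
(* all_boot hides Defs.tsize behind the tsize of tuples. *)
Import Defs.
Set Implicit Arguments. Unset Strict Implicit. Unset Printing Implicit Defensive.
Import GRing.Theory.

(** * Forests, their restrictions and cuts *)

Local Notation forest := (seq tree).

(** [tree] nests [seq], so the claim is moved to [children t]: a [fix] on trees with an inner list
    induction is then guarded. *)
Lemma forest_ind (P : forest -> Prop) :
  P [::] -> (forall cs F, P cs -> P F -> P (Node cs :: F)) -> forall F, P F.
Proof.
move=> P0 PS.
suff PT : forall t : tree, P (children t).
  by move=> F; exact: (PT (Node F)).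
fix IH 1; case=> cs /=; elim: cs => [//|c F IHF].
by move: (IH c); case: c => cs /= IHc; apply: PS.
Qed.

Definition fsize (F : forest) : nat := sumn (map tsize F).

(** Names the anonymous inner fixpoint of [graft], as [frestr] does for [restr]. *)
Fixpoint fgraft (g : nat -> forest) (F : forest) : forest :=
  if F is c :: F' then graft g c :: fgraft (fun i => g (i + tsize c)) F'
  else [::].

Lemma restr_Node keep cs :
  restr keep (Node cs) =
  if keep (fsize cs) then [:: Node (frestr keep cs)] else frestr keep cs.
Proof.
rewrite [LHS]/=.
match goal with |- (if _ then [:: Node ?G] else _) = _ =>
  have -> : G = frestr keep cs by elim: cs keep => //= c cs IH k; rewrite IH
end.
by [].
Qed.

Lemma graft_Node g cs : graft g (Node cs) = Node (fgraft g cs ++ g (fsize cs)).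
Proof.
by rewrite /=; congr (Node (_ ++ _)); elim: cs g => //= c cs IH g; rewrite IH.
Qed.

Lemma frestr_cons keep cs F :
  frestr keep (Node cs :: F) =
  (if keep (fsize cs) then [:: Node (frestr keep cs)] else frestr keep cs)
    ++ frestr (fun i => keep (i + (fsize cs).+1)) F.
Proof. by rewrite -restr_Node. Qed.

Lemma fgraft_cons g cs F :
  fgraft g (Node cs :: F) =
  Node (fgraft g cs ++ g (fsize cs)) :: fgraft (fun i => g (i + (fsize cs).+1)) F.
Proof. by rewrite -graft_Node. Qed.

Lemma fsize_cons cs F : fsize (Node cs :: F) = (fsize cs).+1 + fsize F.
Proof. by []. Qed.

Lemma fsize_cat F G : fsize (F ++ G) = fsize F + fsize G.
Proof. by rewrite /fsize map_cat sumn_cat. Qed.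

Lemma fsize_eq0 F : (fsize F == 0) = (F == [::]).
Proof. by case: F => [|[cs] F]. Qed.

Lemma eq_frestr k1 k2 F :
  (forall x, x < fsize F -> k1 x = k2 x) -> frestr k1 F = frestr k2 F.
Proof.
elim/forest_ind: F k1 k2 => [//|cs F IHc IHF] k1 k2 E.
rewrite !frestr_cons; rewrite fsize_cons in E.
rewrite (IHc k1 k2) => [|x xl]; last by apply: E; lia.
rewrite (E (fsize cs)); last by lia.
by congr (_ ++ _); apply: IHF => x xl; apply: E; lia.
Qed.

Lemma eq_fgraft g1 g2 F :
  (forall x, x < fsize F -> g1 x = g2 x) -> fgraft g1 F = fgraft g2 F.
Proof.
elim/forest_ind: F g1 g2 => [//|cs F IHc IHF] g1 g2 E.
rewrite !fgraft_cons; rewrite fsize_cons in E.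
rewrite (IHc g1 g2) => [|x xl]; last by apply: E; lia.
rewrite (E (fsize cs)); last by lia.
by congr (_ :: _); apply: IHF => x xl; apply: E; lia.
Qed.

Lemma frestr_true F : frestr xpredT F = F.
Proof. by elim/forest_ind: F => // cs F IHc IHF; rewrite frestr_cons IHc IHF. Qed.

Lemma frestr_false F : frestr xpred0 F = [::].
Proof. by elim/forest_ind: F => // cs F IHc IHF; rewrite frestr_cons IHc IHF. Qed.

Lemma frestr_cat keep F G :
  frestr keep (F ++ G) = frestr keep F ++ frestr (fun i => keep (i + fsize F)) G.
Proof.
elim: F keep => [|c F IH] keep /=; first by apply: eq_frestr => x _; rewrite addn0.
rewrite -catA IH; congr (_ ++ (_ ++ _)).
by apply: eq_frestr => x _; congr keep; rewrite /fsize /=; lia.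
Qed.

Lemma fsize_frestr q F : fsize (frestr q F) = count q (iota 0 (fsize F)).
Proof.
elim/forest_ind: F q => [//|cs F IHc IHF] q.
rewrite frestr_cons fsize_cat IHF fsize_cons iotaD count_cat; congr (_ + _).
  rewrite -addn1 iotaD count_cat /= add0n addn0 -IHc.
  by case: (q _); rewrite ?addn0 // fsize_cons addn0 addn1.
rewrite add0n -[in RHS](addn0 (fsize cs).+1) iotaDl count_map.
by apply: eq_count => x /=; rewrite addnC.
Qed.

(** Deletion preserves post-order, so the new number of a surviving node [x] is the number of kept
    nodes before it. *)
Lemma frestr_comp p q F :
  frestr p (frestr q F) = frestr (fun x => q x && p (count q (iota 0 x))) F.
Proof.
elim/forest_ind: F p q => [//|cs F IHc IHF] p q.
rewrite [in RHS]frestr_cons (frestr_cons q) frestr_cat IHF.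
congr (_ ++ _).
  case: (q (fsize cs)); rewrite ?andTb; last exact: IHc.
  by rewrite frestr_cons cats0 IHc fsize_frestr.
apply: eq_frestr => x _; congr (_ && p _).
rewrite [x + _]addnC iotaD count_cat addnC; congr (_ + _).
  rewrite -addn1 iotaD count_cat /= add0n addn0 -fsize_frestr.
  by case: (q _); rewrite ?addn0 // fsize_cons addn0 addn1.
rewrite add0n -[in RHS](addn0 (fsize cs).+1) iotaDl count_map.
by apply: eq_count => y /=; rewrite addnC.
Qed.

Lemma eq_map_iota T (f g : nat -> T) m n :
  (forall k, m <= k < m + n -> f k = g k) -> map f (iota m n) = map g (iota m n).
Proof. by move=> fg; apply/eq_in_map => k; rewrite mem_iota => /fg. Qed.

(** * The coproduct on forests *)

Definition fcop (F : forest) : seq (forest * forest) :=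
  [seq (frestr (gtn k) F, frestr (leq k) F) | k <- iota 0 (fsize F).+1].

#[local] Arguments fcop : simpl never.

Lemma fcop_nil : fcop [::] = [:: ([::], [::])].
Proof. by []. Qed.

(** The root of the first tree has number [fsize cs]: a cut [k <= fsize cs] puts that root and [F]
    on the right, a later one keeps the whole first tree on the left. *)
Lemma fcop_cons cs F :
  fcop (Node cs :: F) =
  [seq (p.1, Node p.2 :: F) | p <- fcop cs]
    ++ [seq (Node cs :: p.1, p.2) | p <- fcop F].
Proof.
rewrite /fcop fsize_cons -addnS iotaD map_cat -!map_comp; congr (_ ++ _).
  apply: eq_map_iota => k kl.
  congr (_, _); rewrite frestr_cons.
    rewrite ifF /=; last by lia.
    by rewrite (@eq_frestr _ xpred0 F) ?frestr_false ?cats0 // => x _ /=; lia.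
  rewrite ifT; last by lia.
  by rewrite (@eq_frestr _ xpredT F) ?frestr_true // => x _ /=; lia.
rewrite add0n -[X in iota X _](addn0 (fsize cs).+1) iotaDl -map_comp.
apply/eq_map => k; congr (_, _); rewrite frestr_cons.
  rewrite ifT; last by rewrite /=; lia.
  rewrite (@eq_frestr _ xpredT cs) ?frestr_true => [|x xl]; last by rewrite /=; lia.
  by congr (_ :: _); apply: eq_frestr => x _ /=; lia.
rewrite ifF; last by lia.
rewrite (@eq_frestr _ xpred0 cs) ?frestr_false => [|x xl]; last by lia.
by apply: eq_frestr => x _ /=; lia.
Qed.

Lemma tcoprodE t :
  tcoprod t = [seq (Node p.1, Node p.2) | p <- fcop (children t)].
Proof.
case: t => F; rewrite /tcoprod /fcop /deg -map_comp.
apply: eq_map_iota => k kl.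
rewrite /tint /restrict /=; congr (Node _, Node _);
  apply: eq_frestr => x; rewrite /fsize /=; lia.
Qed.

Section CoproductSums.
Variable V : nmodType.
Local Open Scope ring_scope.

Lemma sum_fcop_cons cs F (h : forest -> forest -> V) :
  \sum_(p <- fcop (Node cs :: F)) h p.1 p.2 =
  \sum_(p <- fcop cs) h p.1 (Node p.2 :: F)
    + \sum_(p <- fcop F) h (Node cs :: p.1) p.2.
Proof. by rewrite fcop_cons big_cat !big_map. Qed.

(** Sorted by where the two cuts fall: both in [cs] or both in [F] is an induction hypothesis, one
    in each is an exchange of independent sums. *)
Lemma fcop_coassoc F (h : forest -> forest -> forest -> V) :
  \sum_(p <- fcop F) \sum_(q <- fcop p.1) h q.1 q.2 p.2 =
  \sum_(p <- fcop F) \sum_(q <- fcop p.2) h p.1 q.1 q.2.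
Proof.
elim/forest_ind: F h => [|cs F IHc IHF] h; first by rewrite fcop_nil !big_seq1.
rewrite (sum_fcop_cons _ _ (fun A B => \sum_(q <- fcop A) h q.1 q.2 B)).
rewrite (sum_fcop_cons _ _ (fun A B => \sum_(q <- fcop B) h A q.1 q.2)).
rewrite (IHc (fun A B C => h A B (Node C :: F))).
under [X in _ + X = _]eq_bigr do
  rewrite (sum_fcop_cons _ _ (fun A B => h A B _)).
under [X in _ = X + _]eq_bigr do
  rewrite (sum_fcop_cons _ _ (fun A B => h _ A B)).
rewrite !big_split -!addrA; congr (_ + _).
rewrite (IHF (fun A B C => h (Node cs :: A) B C)); congr (_ + _).
exact: exchange_big.
Qed.

Lemma fcop_counitl F (h : forest -> V) :
  \sum_(p <- fcop F) (if p.1 == [::] then h p.2 else 0) = h F.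
Proof.
elim/forest_ind: F h => [|cs F IHc IHF] h; first by rewrite fcop_nil big_seq1.
rewrite (sum_fcop_cons _ _ (fun A B => if A == [::] then h B else 0)).
by rewrite (IHc (fun A => h (Node A :: F))) [X in _ + X]big1 ?addr0.
Qed.

Lemma fcop_counitr F (h : forest -> V) :
  \sum_(p <- fcop F) (if p.2 == [::] then h p.1 else 0) = h F.
Proof.
elim/forest_ind: F h => [|cs F IHc IHF] h; first by rewrite fcop_nil big_seq1.
rewrite (sum_fcop_cons _ _ (fun A B => if B == [::] then h A else 0)).
by rewrite (IHF (fun A => h (Node cs :: A))) big1 ?add0r.
Qed.

End CoproductSums.

(** * The product through iterated coproducts *)

(** The iterated coproduct with [N] factors, the counit for [N = 0]. Empty factors stand for nodes
    that receive no block. *)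
Fixpoint dist (N : nat) (G : forest) : seq (seq forest) :=
  if N is N'.+1 then [seq p.1 :: l | p <- fcop G, l <- dist N' p.2]
  else if G == [::] then [:: [::]] else [::].

Lemma size_dist N G l : l \in dist N G -> size l = N.
Proof.
elim: N G l => [|N IH] G l; first by rewrite /=; case: ifP => // _; rewrite inE => /eqP->.
by case/allpairsPdep => p [l' [_ /IH sz ->]] /=; rewrite sz.
Qed.

Lemma sum_dist0 (V : nmodType) G (h : seq forest -> V) :
  (\sum_(l <- dist 0 G) h l = if G == [::] then h [::] else 0)%R.
Proof. by rewrite /=; case: ifP; rewrite ?big_seq1 ?big_nil. Qed.

Lemma sum_distS (V : nmodType) N G (h : seq forest -> V) :
  (\sum_(l <- dist N.+1 G) h l =
   \sum_(p <- fcop G) \sum_(l <- dist N p.2) h (p.1 :: l))%R.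
Proof. by rewrite big_allpairs_dep. Qed.

Lemma sum_dist_add (V : nmodType) a b G (h : seq forest -> V) :
  (\sum_(l <- dist (a + b) G) h l =
   \sum_(p <- fcop G) \sum_(l <- dist a p.1) \sum_(l' <- dist b p.2)
     h (l ++ l'))%R.
Proof.
elim: a G h => [|a IH] G h.
  under [RHS]eq_bigr do rewrite sum_dist0.
  by rewrite (fcop_counitl _ (fun A => \sum_(l' <- dist b A) h l')%R).
rewrite addSn sum_distS; under eq_bigr do rewrite IH.
under [RHS]eq_bigr do rewrite sum_distS.
by rewrite (fcop_coassoc _ (fun A B C => \sum_(l <- dist a B)
  \sum_(l' <- dist b C) h (A :: l ++ l'))%R).
Qed.

(* Insert G below the nodes of F (starF), resp. of the tree with root-subtrees F,
   root included (starT). *)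
Definition starF (F G : forest) : seq forest :=
  [seq fgraft (nth [::] l) F | l <- dist (fsize F) G].

Definition starT (F G : forest) : seq forest :=
  [seq fgraft (nth [::] l) F ++ nth [::] l (fsize F) | l <- dist (fsize F).+1 G].

Section ProductSums.
Variable V : nmodType.
Local Open Scope ring_scope.

Lemma starF_nil G (h : forest -> V) :
  \sum_(A <- starF [::] G) h A = if G == [::] then h [::] else 0.
Proof. by rewrite big_map sum_dist0. Qed.

(** The root is last in post-order, so it receives the last factor, to the right of the
    root-subtrees. *)
Lemma sum_starT F G (h : forest -> V) :
  \sum_(A <- starT F G) h A =
  \sum_(p <- fcop G) \sum_(A <- starF F p.1) h (A ++ p.2).
Proof.
rewrite big_map -addn1 sum_dist_add; apply: eq_bigr => p _.
rewrite big_map; apply: eq_big_seq => l /size_dist sz.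
rewrite sum_distS; under eq_bigr do rewrite sum_dist0.
rewrite (fcop_counitr _ (fun B =>
  h (fgraft (nth [::] (l ++ [:: B])) F ++ nth [::] (l ++ [:: B]) (fsize F)))).
rewrite nth_cat sz ltnn subnn /=; congr (h (_ ++ _)).
by apply: eq_fgraft => x xl; rewrite nth_cat sz xl.
Qed.

(** The nodes of the first tree come first in post-order, so one cut of [G] separates what they
    receive from what [F] receives. *)
Lemma starF_cons cs F G (h : forest -> V) :
  \sum_(A <- starF (Node cs :: F) G) h A =
  \sum_(p <- fcop G) \sum_(A <- starT cs p.1) \sum_(B <- starF F p.2)
    h (Node A :: B).
Proof.
rewrite big_map fsize_cons sum_dist_add; apply: eq_bigr => p _.
rewrite big_map; apply: eq_big_seq => l /size_dist sz.
rewrite big_map; apply: eq_bigr => l' _; rewrite fgraft_cons.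
rewrite nth_cat sz ltnSn; congr (h (Node (_ ++ _) :: _)).
  by apply: eq_fgraft => x xl; rewrite nth_cat sz ltnS ltnW.
by apply: eq_fgraft => x xl; rewrite nth_cat sz addnC ltnNge leq_addr addKn.
Qed.

Lemma starF_nilr F (h : forest -> V) : \sum_(A <- starF F [::]) h A = h F.
Proof.
elim/forest_ind: F h => [|cs F IHc IHF] h; first by rewrite starF_nil.
rewrite starF_cons fcop_nil big_seq1 sum_starT fcop_nil big_seq1.
by rewrite IHc cats0 IHF.
Qed.

Lemma starT_nilr F (h : forest -> V) : \sum_(A <- starT F [::]) h A = h F.
Proof. by rewrite sum_starT fcop_nil big_seq1 starF_nilr cats0. Qed.

End ProductSums.

(** * Partitions as iterated coproducts *)

Definition cuts (b j : nat) : seq (seq nat) :=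
  [seq rcons (mask m (iota b j)) (b + j) | m <- bseqs j].

(** The possible continuations of a cut sequence after the cut [a], up to the final cut [n]. *)
Definition cutsto (n a : nat) : seq (seq nat) :=
  if a == n then [:: [::]] else cuts a.+1 (n - a.+1).

(** Sorts by the first entry, which is [b] exactly when the mask starts with [true]; [bseqs] lists
    [true] first, so even the orders agree. *)
Lemma cuts_rec b j :
  cuts b j = [seq k :: r | k <- iota b j.+1, r <- cutsto (b + j) k].
Proof.
elim: j b => [|j IH] b; first by rewrite /cuts /cutsto /= addn0 eqxx.
rewrite {1}/cuts [bseqs _]/= map_cat cats0 -!map_comp.
rewrite -[RHS]/(map (cons b) (cutsto (b + j.+1) b)
  ++ [seq k :: r | k <- iota b.+1 j.+1, r <- cutsto (b + j.+1) k]).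
rewrite addnS -addSn -IH; congr (_ ++ _).
rewrite /cutsto ifF; last by lia.
rewrite (_ : b.+1 + j - b.+1 = j); last by lia.
by rewrite /cuts -map_comp.
Qed.

(** Uses 0-based half-open intervals where [tint] has 1-based closed ones. *)
Fixpoint fblocks (G : forest) (a : nat) (c : seq nat) : seq forest :=
  if c is k :: c' then frestr (fun x => a <= x < k) G :: fblocks G k c' else [::].

Lemma size_fblocks G a c : size (fblocks G a c) = size c.
Proof. by elim: c a => //= k c IH a; rewrite IH. Qed.

Lemma blocksE u a c : blocks u (a :: c) = map Node (fblocks (children u) a c).
Proof.
by rewrite /blocks /=; elim: c a => //= k c IH a; rewrite IH.
Qed.

(** Turns a partition and an increasing map, given by its mask [s], into one factor per node. *)
Fixpoint fill (s : bitseq) (bs : seq forest) : seq forest :=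
  match s with
  | [::] => [::]
  | true :: s' => head [::] bs :: fill s' (behead bs)
  | false :: s' => [::] :: fill s' bs
  end.

(* dist with absolute cut positions in G, starting after the first a nodes. *)
Fixpoint distA (N : nat) (G : forest) (a : nat) : seq (seq forest) :=
  if N is N'.+1 then
    [seq frestr (fun x => a <= x < k) G :: l
       | k <- iota a (fsize G - a).+1, l <- distA N' G k]
  else if a == fsize G then [:: [::]] else [::].

Lemma count_leq_iota a n :
  count (leq a) (iota 0 n) = n - a.
Proof.
by elim: n => // n IH; rewrite -addn1 iotaD count_cat IH /=; lia.
Qed.

(** Restriction to the nodes from [a] on lowers their numbers by [a], so the relative cut [k] is the
    absolute cut [a + k]. *)
Lemma distA_dist N G a :
  a <= fsize G -> distA N G a = dist N (frestr (leq a) G).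
Proof.
elim: N a => [|N IH] a an.
  by rewrite /= -fsize_eq0 fsize_frestr count_leq_iota subn_eq0 eqn_leq an.
rewrite -[dist _ _]/[seq p.1 :: l | p <- fcop (frestr (leq a) G), l <- dist N p.2].
rewrite -[distA _ _ _]/[seq frestr (fun x => a <= x < k) G :: l
       | k <- iota a (fsize G - a).+1, l <- distA N G k].
rewrite /fcop fsize_frestr count_leq_iota -[X in iota X _](addn0 a) iotaDl.
rewrite -!map_comp; congr flatten; apply: eq_map_iota => k kn.
rewrite /comp IH; last by lia.
rewrite !frestr_comp /=.
have -> : frestr (leq (a + k)) G
    = frestr (fun x => (a <= x) && (k <= count (leq a) (iota 0 x))) G.
  by apply: eq_frestr => x _; rewrite count_leq_iota; lia.
apply: eq_map => l; congr (_ :: _).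
by apply: eq_frestr => x _; rewrite /= count_leq_iota; lia.
Qed.

Lemma cutsto_lt n a :
  a < n -> cutsto n a = [seq k :: r | k <- iota a.+1 (n - a), r <- cutsto n k].
Proof.
move=> an; rewrite {1}/cutsto ifF; last by lia.
by rewrite cuts_rec subnSK // subnKC.
Qed.

Section Bridge.
Variable V : nmodType.
Local Open Scope ring_scope.

Lemma frestr_itv0 a G : frestr (fun x => a <= x < a)%N G = [::].
Proof. by rewrite -[RHS](frestr_false G); apply: eq_frestr => x _ /=; lia. Qed.

Lemma sum_bseqsS N (P : pred bitseq) (h : bitseq -> V) :
  \sum_(s <- bseqs N.+1 | P s) h s =
  \sum_(s <- bseqs N | P (false :: s)) h (false :: s)
    + \sum_(s <- bseqs N | P (true :: s)) h (true :: s).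
Proof. by rewrite addrC [bseqs _]/= cats0 big_cat !big_map. Qed.

Lemma sum_distAS N a G (h : seq forest -> V) :
  \sum_(l <- distA N.+1 G a) h l =
  \sum_(l <- distA N G a) h ([::] :: l)
    + \sum_(k <- iota a.+1 (fsize G - a)) \sum_(l <- distA N G k)
         h (frestr (fun x => a <= x < k)%N G :: l).
Proof.
rewrite big_allpairs_dep.
by rewrite -[iota a _]/(a :: iota a.+1 (fsize G - a)) big_cons frestr_itv0.
Qed.

(** The bijection behind the product formula, by induction on the nodes: an unmarked node takes an
    empty interval, a marked one the nonempty interval up to the next cut. *)
Lemma sum_fill N a G (h : seq forest -> V) : (a <= fsize G)%N ->
  \sum_(c <- cutsto (fsize G) a) \sum_(s <- bseqs N | count id s == size c)
     h (fill s (fblocks G a c)) =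
  \sum_(l <- distA N G a) h l.
Proof.
elim: N a h => [|N IH] a h an.
  rewrite /= /cutsto; case: ifP => [_|an'].
    by rewrite !big_seq1 big_cons big_nil addr0.
  rewrite /cuts big_map big_nil big1 // => m _.
  by rewrite big_cons big_nil size_rcons.
under eq_bigr do rewrite sum_bseqsS.
rewrite big_split (IH a (fun l => h ([::] :: l))) //.
rewrite -/(distA N.+1 G a) sum_distAS; congr (_ + _).
case: (ltngtP a (fsize G)) an => // [alt _|-> _]; last first.
  (* No block is left, so no mask starting with [true] has the required count. *)
  rewrite subnn big_nil /cutsto eqxx big_seq1 big1 //.
rewrite cutsto_lt // big_allpairs_dep; apply: eq_big_seq => k.
rewrite mem_iota => kn.
by rewrite /= (IH k (fun l => h (_ :: l))) //; lia.
Qed.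

End Bridge.

Lemma size_bseqs n m : m \in bseqs n -> size m = n.
Proof.
elim: n m => [|n IH] m; first by rewrite inE => /eqP->.
by case/allpairsP => -[b s] [_ /= /IH sz ->] /=; rewrite sz.
Qed.

(** [hash] finds a block by the rank of its node in [f], [fill] by position; the offset [x0] lets
    the induction pass to the tail of the mask. *)
Lemma nth_fill x0 m bs x : x < size m -> count id m = size bs ->
  let f := mask m (iota x0 (size m)) in
  nth [::] (fill m bs) x =
  if x0 + x \in f then children (nth odot (map Node bs) (index (x0 + x) f))
  else [::].
Proof.
elim: m x0 bs x => // b m IH x0 bs [|x] xm sz.
  rewrite addn0; case: b xm sz => /= xm sz; last first.
    rewrite ifN //; apply/negP => /mem_mask; rewrite mem_iota; lia.
  by rewrite inE eqxx; case: bs sz.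
have x0x : (x0 == x0 + x.+1) = false by lia.
case: b xm sz => /= xm sz; last by rewrite (IH x0.+1) // addSnnS.
case: bs sz => //= b bs [sz].
by rewrite inE [_ == x0]eq_sym x0x /= (IH x0.+1) // addSnnS.
Qed.

Lemma eq_graft g1 g2 t :
  (forall x, x < tsize t -> g1 x = g2 x) -> graft g1 t = graft g2 t.
Proof.
move=> E; suff [] : fgraft g1 [:: t] = fgraft g2 [:: t] by [].
by apply: eq_fgraft => x; rewrite /fsize /= addn0; apply: E.
Qed.

Lemma hash_fill t bs m : size m = tsize t -> count id m = size bs ->
  hash t (map Node bs) (mask m (iota 0 (tsize t))) =
  graft (nth [::] (fill m bs)) t.
Proof.
move=> sm sz; apply: eq_graft => x xt.
by rewrite (nth_fill 0) ?sm.
Qed.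

Lemma sum_tstar (V : nmodType) t u (h : tree -> V) :
  (\sum_(a <- tstar t u) h a =
   \sum_(A <- starT (children t) (children u)) h (Node A))%R.
Proof.
case: t u => F [G] /=; rewrite /tstar -[deg _]/(fsize G).
case: ifP => [|G0].
  by rewrite fsize_eq0 => /eqP->; rewrite starT_nilr big_seq1.
transitivity (\sum_(l <- distA (tsize (Node F)) G 0)
    h (graft (nth [::] l) (Node F)))%R; last first.
  rewrite distA_dist // (@eq_frestr _ xpredT) // frestr_true big_map.
  by apply: eq_bigr => l _; rewrite graft_Node.
rewrite -(sum_fill _ (fun l => h (graft (nth [::] l) (Node F)))) //.
(* Without their leading 0, the sequences of [cutseqs] are those of [cutsto (fsize G) 0]. *)
rewrite big_flatten !big_map /cutsto eq_sym G0.
have -> : cuts 1 (fsize G - 1)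
    = [seq rcons (mask m (iota 1 (fsize G).-1)) (fsize G) | m <- bseqs (fsize G).-1].
  by rewrite /cuts subn1 add1n prednK // lt0n G0.
rewrite big_map; apply: eq_bigr => m _.
rewrite big_map /incmaps big_map big_filter blocksE size_map size_fblocks.
rewrite big_seq_cond [RHS]big_seq_cond; apply: eq_bigr => s /andP[/size_bseqs ss /eqP sz].
by rewrite hash_fill // size_fblocks.
Qed.

(** * Compatibility and associativity *)

Section BialgebraSums.
Variable V : nmodType.
Local Open Scope ring_scope.
Implicit Types (F G H cs : forest).

Lemma starF_cat F1 F2 G (h : forest -> V) :
  \sum_(A <- starF (F1 ++ F2) G) h A =
  \sum_(p <- fcop G) \sum_(A <- starF F1 p.1) \sum_(B <- starF F2 p.2) h (A ++ B).
Proof.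
elim/forest_ind: F1 G h => [|cs F _ IH] G h.
  under [RHS]eq_bigr do rewrite starF_nil.
  by rewrite (fcop_counitl _ (fun X => \sum_(B <- starF F2 X) h B)).
rewrite [LHS]starF_cons.
under eq_bigr => p _ do under eq_bigr => A _ do rewrite IH.
under eq_bigr => p _ do rewrite exchange_big.
rewrite -(fcop_coassoc G (fun X Y Z => \sum_(A <- starT cs X)
  \sum_(B <- starF F Y) \sum_(C <- starF F2 Z) h (Node A :: B ++ C))).
by apply: eq_bigr => p _; rewrite starF_cons.
Qed.

(** Post-order lists [F1], then [F2], then the root, so the root's factor stays with [F2]. *)
Lemma starT_cat F1 F2 G (h : forest -> V) :
  \sum_(A <- starT (F1 ++ F2) G) h A =
  \sum_(p <- fcop G) \sum_(A <- starF F1 p.1) \sum_(B <- starT F2 p.2) h (A ++ B).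
Proof.
rewrite sum_starT; under eq_bigr do rewrite starF_cat.
rewrite (fcop_coassoc G (fun X Y Z => \sum_(A <- starF F1 X)
  \sum_(B <- starF F2 Y) h ((A ++ B) ++ Z))).
apply: eq_bigr => p _; rewrite exchange_big; apply: eq_bigr => A _.
by rewrite sum_starT; under eq_bigr do under eq_bigr do rewrite -catA.
Qed.

Lemma starT_cons cs F G (h : forest -> V) :
  \sum_(A <- starT (Node cs :: F) G) h A =
  \sum_(p <- fcop G) \sum_(A <- starT cs p.1) \sum_(B <- starT F p.2) h (Node A :: B).
Proof.
rewrite sum_starT; under eq_bigr do rewrite starF_cons.
rewrite (fcop_coassoc G (fun X Y Z => \sum_(A <- starT cs X)
  \sum_(B <- starF F Y) h ((Node A :: B) ++ Z))).
apply: eq_bigr => p _; rewrite exchange_big; apply: eq_bigr => A _.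
by rewrite sum_starT.
Qed.

Lemma starT_nill G (h : forest -> V) : \sum_(A <- starT [::] G) h A = h G.
Proof.
rewrite sum_starT; under eq_bigr do rewrite starF_nil.
exact: fcop_counitl.
Qed.

Lemma starT_counit F G (a : V) :
  \sum_(A <- starT F G) (if A == [::] then a else 0) =
  if (F == [::]) && (G == [::]) then a else 0.
Proof.
case: F => [|[cs] F]; first by rewrite starT_nill.
by rewrite starT_cons big1 // => p _; rewrite big1 // => A _; rewrite big1.
Qed.

Lemma sum_fcop_cons_neq0 cs F (h : forest -> forest -> V) :
  \sum_(p <- fcop (Node cs :: F) | p.2 != [::]) h p.1 p.2 =
  \sum_(p <- fcop cs) h p.1 (Node p.2 :: F)
    + \sum_(p <- fcop F | p.2 != [::]) h (Node cs :: p.1) p.2.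
Proof. by rewrite fcop_cons big_cat !big_map. Qed.

(** The cut between [F1] and [F2] belongs to the second sum; [p.2 != [::]] keeps it out of the
    first. *)
Lemma sum_fcop_cat F1 F2 (h : forest -> forest -> V) :
  \sum_(p <- fcop (F1 ++ F2)) h p.1 p.2 =
  \sum_(p <- fcop F1 | p.2 != [::]) h p.1 (p.2 ++ F2)
    + \sum_(p <- fcop F2) h (F1 ++ p.1) p.2.
Proof.
elim/forest_ind: F1 h => [|cs F _ IH] h.
  by rewrite fcop_nil [X in _ = X + _]big_mkcond big_seq1 add0r.
rewrite sum_fcop_cons (IH (fun X Y => h (Node cs :: X) Y)) addrA.
by rewrite (sum_fcop_cons_neq0 cs F (fun X Y => h X (Y ++ F2))).
Qed.

(** Stated as an implication because the induction in [fcop_starF] needs the rooted form for [cs]. A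
    cut of [A ++ q.2] leaves a nonempty part of [A] on the right or falls in [q.2]. *)
Lemma fcop_starT_of_starF F G :
  (forall G' (h : forest -> forest -> V),
    \sum_(A <- starF F G') \sum_(p <- fcop A | p.2 != [::]) h p.1 p.2 =
    \sum_(p <- fcop F | p.2 != [::]) \sum_(q <- fcop G')
      \sum_(A <- starT p.1 q.1) \sum_(B <- starF p.2 q.2) h A B) ->
  forall h : forest -> forest -> V,
  \sum_(A <- starT F G) \sum_(p <- fcop A) h p.1 p.2 =
  \sum_(p <- fcop F) \sum_(q <- fcop G)
    \sum_(A <- starT p.1 q.1) \sum_(B <- starT p.2 q.2) h A B.
Proof.
move=> fcopF h; rewrite sum_starT.
under eq_bigr => q _ do under eq_bigr => A _ do rewrite sum_fcop_cat.
under eq_bigr => q _ do rewrite big_split.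
rewrite big_split [RHS](bigID (fun p => p.2 != [::])); congr (_ + _).
  under eq_bigr => q _ do rewrite (fcopF _ (fun X Y => h X (Y ++ q.2))).
  rewrite exchange_big; apply: eq_bigr => p _.
  rewrite (fcop_coassoc G (fun X Y Z => \sum_(A <- starT p.1 X)
    \sum_(B <- starF p.2 Y) h A (B ++ Z))).
  apply: eq_bigr => q _; rewrite exchange_big; apply: eq_bigr => A _.
  by rewrite sum_starT.
rewrite [RHS]big_mkcond.
(* For [p.2] empty, [starT p.2] is the identity; the right counit law then leaves only [p.1 = F]. *)
transitivity (\sum_(p <- fcop F) (if p.2 == [::] then
    \sum_(q <- fcop G) \sum_(A <- starT p.1 q.1) h A q.2 else 0)); last first.
  apply: eq_bigr => p _; rewrite negbK; case: eqP => // ->.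
  by apply: eq_bigr => q _; apply: eq_bigr => A _; rewrite starT_nill.
rewrite (fcop_counitr F (fun X => \sum_(q <- fcop G) \sum_(A <- starT X q.1) h A q.2)).
under [RHS]eq_bigr do rewrite sum_starT.
rewrite (fcop_coassoc G (fun X Y Z => \sum_(A <- starF F X) h (A ++ Y) Z)).
by apply: eq_bigr => q _; rewrite exchange_big.
Qed.

(* In a forest A of starF F G the last node belongs to F, so a cut of A with a
   nonempty right part comes from a cut of F with a nonempty right part. *)
Lemma fcop_starF F G (h : forest -> forest -> V) :
  \sum_(A <- starF F G) \sum_(p <- fcop A | p.2 != [::]) h p.1 p.2 =
  \sum_(p <- fcop F | p.2 != [::]) \sum_(q <- fcop G)
    \sum_(A <- starT p.1 q.1) \sum_(B <- starF p.2 q.2) h A B.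
Proof.
elim/forest_ind: F G h => [|cs F IHc IHF] G h.
  by rewrite starF_nil fcop_nil [RHS]big_mkcond [in LHS]big_mkcond !big_seq1 if_same.
rewrite starF_cons.
under eq_bigr => q _ do under eq_bigr => A _ do under eq_bigr => B _ do
  rewrite sum_fcop_cons_neq0.
under eq_bigr => q _ do under eq_bigr => A _ do rewrite big_split.
under eq_bigr => q _ do rewrite big_split.
rewrite big_split (sum_fcop_cons_neq0 cs F (fun X Y => \sum_(q <- fcop G)
    \sum_(A <- starT X q.1) \sum_(B <- starF Y q.2) h A B)).
congr (_ + _).
  (* Cuts inside the first tree: its root goes to the right, and the rooted form applies to [cs]. *)
  under eq_bigr => q _ do rewrite exchange_big.
  under eq_bigr => q _ do under eq_bigr => B _ do rewrite
    (@fcop_starT_of_starF cs q.1 IHc (fun X Y => h X (Node Y :: B))).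
  under eq_bigr => q _ do rewrite exchange_big.
  rewrite exchange_big; apply: eq_bigr => p _.
  under eq_bigr => q _ do rewrite exchange_big.
  rewrite (fcop_coassoc G (fun X Y Z => \sum_(B <- starF F Z)
    \sum_(A <- starT p.1 X) \sum_(C <- starT p.2 Y) h A (Node C :: B))).
  apply: eq_bigr => q _; under [RHS]eq_bigr => A _ do rewrite starF_cons.
  rewrite [RHS]exchange_big; apply: eq_bigr => r _.
  rewrite exchange_big; apply: eq_bigr => A _; exact: exchange_big.
(* Cuts after the first tree: it stays whole on the left, and the hypothesis on [F] applies. *)
under eq_bigr => q _ do under eq_bigr => A _ do rewrite
  (IHF _ (fun X Y => h (Node A :: X) Y)).
under eq_bigr => q _ do rewrite exchange_big.
rewrite exchange_big; apply: eq_bigr => p _.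
under eq_bigr => q _ do rewrite exchange_big.
rewrite -(fcop_coassoc G (fun X Y Z => \sum_(A <- starT cs X)
    \sum_(C <- starT p.1 Y) \sum_(B <- starF p.2 Z) h (Node A :: C) B)).
by apply: eq_bigr => q _; rewrite starT_cons.
Qed.

Lemma fcop_starT F G (h : forest -> forest -> V) :
  \sum_(A <- starT F G) \sum_(p <- fcop A) h p.1 p.2 =
  \sum_(p <- fcop F) \sum_(q <- fcop G)
    \sum_(A <- starT p.1 q.1) \sum_(B <- starT p.2 q.2) h A B.
Proof. by apply: fcop_starT_of_starF => G' h'; exact: fcop_starF. Qed.

(** Again an implication, for use on [cs] in [starF_assoc]. Compatibility expresses the cuts of
    [starT G H] through cuts of [G] and of [H]. *)
Lemma starT_assoc_of_starF F G H :
  (forall G' H' (h : forest -> V),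
    \sum_(A <- starF F G') \sum_(B <- starF A H') h B =
    \sum_(C <- starT G' H') \sum_(B <- starF F C) h B) ->
  forall h : forest -> V,
  \sum_(A <- starT F G) \sum_(B <- starT A H) h B =
  \sum_(C <- starT G H) \sum_(B <- starT F C) h B.
Proof.
move=> assocF h; rewrite sum_starT.
under eq_bigr => p _ do under eq_bigr => A _ do rewrite starT_cat.
under eq_bigr => p _ do rewrite exchange_big.
under eq_bigr => p _ do under eq_bigr => q _ do rewrite
  (assocF _ _ (fun E => \sum_(C <- starT p.2 q.2) h (E ++ C))).
under [RHS]eq_bigr do rewrite sum_starT.
rewrite (fcop_starT G H (fun X Y => \sum_(E <- starF F X) h (E ++ Y))).
apply: eq_bigr => p _; apply: eq_bigr => q _; apply: eq_bigr => A _.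
exact: exchange_big.
Qed.

Lemma starF_assoc F G H (h : forest -> V) :
  \sum_(A <- starF F G) \sum_(B <- starF A H) h B =
  \sum_(C <- starT G H) \sum_(B <- starF F C) h B.
Proof.
elim/forest_ind: F G H h => [|cs F IHc IHF] G H h.
  (* The empty forest has no node to graft on, so only the counit remains, and it is
     multiplicative. *)
  rewrite starF_nil; under [RHS]eq_bigr do rewrite starF_nil.
  by rewrite starF_nil starT_counit; case: ifP.
rewrite starF_cons.
under eq_bigr => p _ do under eq_bigr => A _ do under eq_bigr => B _ do
  rewrite starF_cons.
under [RHS]eq_bigr do rewrite starF_cons.
rewrite (fcop_starT G H (fun X Y => \sum_(A <- starT cs X)
  \sum_(B <- starF F Y) h (Node A :: B))).
apply: eq_bigr => p _.
under eq_bigr => A _ do rewrite exchange_big.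
rewrite exchange_big; apply: eq_bigr => q _.
under eq_bigr => A _ do rewrite exchange_big.
under eq_bigr => A _ do under eq_bigr => E _ do
  rewrite (IHF _ _ (fun Y => h (Node E :: Y))).
rewrite (@starT_assoc_of_starF cs p.1 q.1 IHc (fun E => \sum_(C <- starT p.2 q.2)
  \sum_(B <- starF F C) h (Node E :: B))).
by apply: eq_bigr => C _; rewrite exchange_big.
Qed.

Lemma starT_assoc F G H (h : forest -> V) :
  \sum_(A <- starT F G) \sum_(B <- starT A H) h B =
  \sum_(C <- starT G H) \sum_(B <- starT F C) h B.
Proof. by apply: starT_assoc_of_starF => G' H' h'; exact: starF_assoc. Qed.

End BialgebraSums.

Lemma fsize_fcop F p : p \in fcop F -> fsize p.1 + fsize p.2 = fsize F.
Proof.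
elim/forest_ind: F p => [|cs F IHc IHF] p; first by rewrite inE => /eqP->.
rewrite fcop_cons mem_cat !fsize_cons.
by case/orP => /mapP[q qin ->]; rewrite !fsize_cons -?(IHc _ qin) -?(IHF _ qin) /=; lia.
Qed.

Lemma fsize_fcop_lt F p :
  p \in fcop F -> p.1 != [::] -> fsize p.2 < fsize F.
Proof. by move=> /fsize_fcop; rewrite -fsize_eq0; lia. Qed.

(** * Formal sums and the antipode *)

Section Pairing.
Variable K : fieldType.
Local Open Scope ring_scope.

Definition dot (T : Type) (x : fsum K T) (h : T -> K) : K :=
  \sum_(p <- x) p.1 * h p.2.

(** The coefficient at [t] is the pairing with the indicator function of [t]. *)
Lemma veq_dot (T : eqType) (x y : fsum K T) :
  (forall h, dot x h = dot y h) -> veq x y.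
Proof.
move=> xy t.
have E z : fcoef z t = dot z (fun s => (s == t)%:R).
  by rewrite /fcoef big_mkcond; apply: eq_bigr => p _; rewrite mulr_natr mulrb.
by rewrite !E.
Qed.

Lemma eq_dot (T : Type) (x : fsum K T) f g : f =1 g -> dot x f = dot x g.
Proof. by move=> fg; apply: eq_bigr => p _; rewrite fg. Qed.

Lemma dot_sum (T I : Type) (x : fsum K T) (r : seq I) (f : I -> T -> K) :
  dot x (fun t => \sum_(i <- r) f i t) = \sum_(i <- r) dot x (f i).
Proof. by rewrite exchange_big; apply: eq_bigr => p _; rewrite mulr_sumr. Qed.

Lemma dot_mulr (T : Type) (x : fsum K T) f a :
  dot x (fun t => f t * a) = dot x f * a.
Proof. by rewrite /dot mulr_suml; apply: eq_bigr => p _; rewrite mulrA. Qed.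

Lemma dot_mull (T : Type) (x : fsum K T) f a :
  dot x (fun t => a * f t) = a * dot x f.
Proof. by rewrite mulrC -dot_mulr; apply: eq_dot => t; rewrite mulrC. Qed.

Lemma dot_map (T U : Type) (g : T -> U) (x : fsum K T) h :
  dot [seq (q.1, g q.2) | q <- x] h = dot x (h \o g).
Proof. by rewrite /dot big_map. Qed.

Lemma dot_opp (T : Type) (x : fsum K T) h :
  dot [seq (- q.1, q.2) | q <- x] h = - dot x h.
Proof. by rewrite /dot big_map -sumrN; under eq_bigr do rewrite mulNr. Qed.

Lemma dot_flatten (T : Type) (xs : seq (fsum K T)) h :
  dot (flatten xs) h = \sum_(x <- xs) dot x h.
Proof. by rewrite /dot big_flatten. Qed.

Lemma dot_ones (T : Type) (s : seq T) h : dot (ones K s) h = \sum_(a <- s) h a.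
Proof. by rewrite /dot big_map; under eq_bigr do rewrite mul1r. Qed.

Lemma dot_single (T : Type) a (t : T) h : dot [:: (a, t)] h = a * h t.
Proof. by rewrite /dot big_seq1. Qed.

Lemma dot_bvec (T : Type) (t : T) h : dot (bvec K t) h = h t.
Proof. by rewrite dot_single mul1r. Qed.

Lemma dot_flin (T U : Type) (f : T -> fsum K U) x h :
  dot (flin f x) h = dot x (fun t => dot (f t) h).
Proof.
rewrite dot_flatten big_map; apply: eq_bigr => p _; rewrite /dot big_map.
by rewrite mulr_sumr; under [RHS]eq_bigr do rewrite mulrA.
Qed.

Lemma dot_bilin (T U W : Type) (f : T -> U -> fsum K W) x y h :
  dot (bilin f x y) h = dot x (fun t => dot y (fun u => dot (f t u) h)).
Proof.
rewrite dot_flatten big_allpairs_dep; apply: eq_bigr => p _.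
rewrite mulr_sumr; apply: eq_bigr => q _; rewrite /dot big_map !mulr_sumr.
by apply: eq_bigr => r _; rewrite !mulrA.
Qed.

Lemma dot_hmul x y h :
  dot (hmul x y) h =
  dot x (fun t => dot y (fun u =>
    \sum_(A <- starT (children t) (children u)) h (Node A))).
Proof.
rewrite dot_bilin; apply: eq_dot => t; apply: eq_dot => u.
by rewrite dot_ones sum_tstar.
Qed.

Lemma dot_coprod x h :
  dot (coprod x) h =
  dot x (fun t => \sum_(p <- fcop (children t)) h (Node p.1, Node p.2)).
Proof.
rewrite dot_flin; apply: eq_dot => t.
by rewrite dot_ones tcoprodE big_map.
Qed.

Lemma dot_hmul2 x y h :
  dot (hmul2 x y) h =
  dot x (fun ab => dot y (fun cd =>
    \sum_(A <- starT (children ab.1) (children cd.1))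
    \sum_(B <- starT (children ab.2) (children cd.2)) h (Node A, Node B))).
Proof.
rewrite dot_bilin; apply: eq_dot => ab; apply: eq_dot => cd.
rewrite /dot big_allpairs_dep big_map /= sum_tstar; apply: eq_bigr => A _.
rewrite big_map /= sum_tstar; apply: eq_bigr => B _.
by rewrite !mul1r.
Qed.

Lemma dot_coprod_l x h :
  dot (coprod_l x) h =
  dot x (fun ab => \sum_(p <- fcop (children ab.1)) h ((Node p.1, Node p.2), ab.2)).
Proof.
rewrite dot_flin; apply: eq_dot => ab.
by rewrite (dot_map (fun q => (q, ab.2))) dot_ones tcoprodE big_map.
Qed.

Lemma dot_coprod_r x h :
  dot (coprod_r x) h =
  dot x (fun ab => \sum_(p <- fcop (children ab.2)) h ((ab.1, Node p.1), Node p.2)).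
Proof.
rewrite dot_flin; apply: eq_dot => ab.
by rewrite (dot_map (fun q => ((ab.1, q.1), q.2))) dot_ones tcoprodE big_map.
Qed.

Lemma eps_tE F : eps_t K (Node F) = if F == [::] then 1 else 0.
Proof. by rewrite /eps_t -[deg _]/(fsize F) fsize_eq0. Qed.

Lemma dot_unitv_eps x h :
  dot (unitv (eps x)) h =
  dot x (fun t => if children t == [::] then h odot else 0).
Proof.
rewrite dot_single -dot_mulr; apply: eq_dot => -[F].
by rewrite eps_tE /=; case: ifP; rewrite ?mul1r ?mul0r.
Qed.

(* The antipode solves sum_(p <- fcop F) p.1 * S p.2 = eps F for the term with
   p.1 empty; n is the recursion fuel. *)
Fixpoint antipode_rec (n : nat) (F : forest) : fsum K tree :=
  if n is n'.+1 then
    if F == [::] then bvec K odot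
    else flatten [seq [seq (- r.1, r.2)
                        | r <- hmul (bvec K (Node p.1)) (antipode_rec n' p.2)]
                   | p <- fcop F & p.1 != [::]]
  else [::].

Lemma antipode_recS n F :
  antipode_rec n.+1 F =
  if F == [::] then bvec K odot
  else flatten [seq [seq (- r.1, r.2)
                      | r <- hmul (bvec K (Node p.1)) (antipode_rec n p.2)]
                 | p <- fcop F & p.1 != [::]].
Proof. by []. Qed.

Definition antipode (t : tree) : fsum K tree :=
  antipode_rec (tsize t) (children t).

Lemma antipode_rec_fuel n m F :
  (fsize F < n)%N -> (fsize F < m)%N -> antipode_rec n F = antipode_rec m F.
Proof.
elim: n m F => // n IH [//|m] F Fn Fm; rewrite !antipode_recS; case: ifP => // F0.
congr flatten; apply/eq_in_map => p.
rewrite mem_filter => /andP[p1 /fsize_fcop_lt/(_ p1) pF].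
by rewrite (IH m) //; apply: leq_trans pF _; rewrite -ltnS.
Qed.

Definition antidot F (h : forest -> K) : K :=
  dot (antipode (Node F)) (h \o children).

Lemma eq_antidot F f g : f =1 g -> antidot F f = antidot F g.
Proof. by move=> fg; apply: eq_dot => t /=. Qed.

Lemma antidot_nil h : antidot [::] h = h [::].
Proof. by rewrite /antidot /antipode /= dot_bvec. Qed.

Lemma antidot_rec F h : F != [::] ->
  antidot F h =
  - \sum_(p <- fcop F | p.1 != [::]) antidot p.2 (fun B => \sum_(A <- starT p.1 B) h A).
Proof.
rewrite {1}/antidot /antipode -[tsize _]/(fsize F).+1 => F0.
rewrite [children _]/= antipode_recS (negPf F0).
rewrite dot_flatten big_map big_filter -sumrN big_seq_cond [RHS]big_seq_cond.
apply: eq_bigr => p /andP[/fsize_fcop_lt + p1] => /(_ p1) pF.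
by rewrite dot_opp dot_hmul dot_bvec (@antipode_rec_fuel _ (fsize p.2).+1).
Qed.

(** Holds by construction: for nonempty [F] the term with [p.1] empty is [antidot F h], which
    [antidot_rec] makes the negative of the rest. *)
Lemma antidot_right F h :
  \sum_(p <- fcop F) antidot p.2 (fun B => \sum_(A <- starT p.1 B) h A) =
  if F == [::] then h [::] else 0.
Proof.
case: ifPn => [/eqP->|F0].
  by rewrite fcop_nil big_seq1 antidot_nil starT_nill.
rewrite (bigID (fun p => p.1 == [::])) /= -[X in _ + X]opprK -antidot_rec //.
apply/eqP; rewrite subr_eq0 -(fcop_counitl F (antidot^~ h)) big_mkcond.
apply/eqP/eq_bigr => p _; case: eqP => // ->.
by apply: eq_antidot => B; rewrite starT_nill.
Qed.

Lemma antidot_left F h :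
  \sum_(p <- fcop F) antidot p.1 (fun A => \sum_(B <- starT A p.2) h B) =
  if F == [::] then h [::] else 0.
Proof.
have [n] := ubnP (fsize F); elim: n F h => // n IH F h Fn.
case: ifPn => [/eqP->|F0].
  by rewrite fcop_nil big_seq1 antidot_nil starT_nill.
(* [L] is the convolution of the antipode with the identity; [EF] convolves it with the identity on
   the left and reassociates. *)
pose L X f := \sum_(p <- fcop X) antidot p.1 (fun A => \sum_(B <- starT A p.2) f B).
have EF : \sum_(p <- fcop F) L p.2 (fun Y => \sum_(Z <- starT p.1 Y) h Z) = h F.
  rewrite -(fcop_coassoc F (fun X Y Z => antidot Y (fun A =>
    \sum_(B <- starT A Z) \sum_(C <- starT X B) h C))).
  rewrite -[RHS](fcop_counitl F h); apply: eq_bigr => p _.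
  under eq_bigr => q _ do under eq_antidot => A do rewrite -starT_assoc.
  rewrite (antidot_right p.1 (fun Y => \sum_(Z <- starT Y p.2) h Z)).
  by rewrite starT_nill.
(* The term with [p.1] empty is [L F h]. The others sum to [h F] by induction, so cancelling [h F]
   gives [L F h = 0]. *)
rewrite (bigID (fun p => p.1 == [::])) /= in EF.
apply: (addIr (h F)); rewrite add0r -[RHS]EF; congr (_ + _).
  rewrite -/(L F h) -(fcop_counitl F (L^~ h)) [RHS]big_mkcond.
  apply: eq_bigr => p _; case: eqP => // ->.
  apply: eq_bigr => q _; apply: eq_antidot => A.
  by apply: eq_bigr => B _; rewrite starT_nill.
transitivity (if F == [::] then 0 else h F); first by rewrite (negPf F0).
(* The value 0 at the empty forest matches the exclusion of terms with [p.1] empty. *)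
rewrite -(fcop_counitr F (fun X => if X == [::] then 0 else h X)).
rewrite [RHS]big_mkcond; apply: eq_big_seq => p /fsize_fcop_lt pF.
case: (eqVneq p.1 [::]) pF => /= [_ _|p1 /(_ isT) pF]; first by rewrite if_same.
by rewrite /L IH ?starT_nilr ?(negPf p1) //; apply: leq_trans pF _; rewrite -ltnS.
Qed.

End Pairing.

(** * The Hopf algebra axioms *)

Local Open Scope ring_scope.

Theorem theorem3p7 (K : fieldType) :
  (* associativity of * *)
  (forall x y z : fsum K tree, veq (hmul (hmul x y) z) (hmul x (hmul y z))) /\
  (* ⊙ is a two-sided unit *)
  (forall x : fsum K tree,
      veq (hmul (bvec K odot) x) x /\ veq (hmul x (bvec K odot)) x) /\
  (* coassociativity of Δ *)
  (forall x : fsum K tree, veq (coprod_l (coprod x)) (coprod_r (coprod x))) /\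
  (* ε is a counit *)
  (forall x : fsum K tree, veq (eps_l (coprod x)) x /\ veq (eps_r (coprod x)) x) /\
  (* Δ and ε are unital algebra morphisms *)
  (forall x y : fsum K tree, veq (coprod (hmul x y)) (hmul2 (coprod x) (coprod y))) /\
  veq (coprod (bvec K odot)) (bvec K (odot, odot)) /\
  (forall x y : fsum K tree, eps (hmul x y) = eps x * eps y) /\
  eps (bvec K odot) = 1 /\
  (* existence of an antipode *)
  (exists S : tree -> fsum K tree,
     forall x : fsum K tree,
       veq (conv_l S (coprod x)) (unitv (eps x)) /\
       veq (conv_r S (coprod x)) (unitv (eps x))).
Proof.
split.
  move=> x y z; apply: veq_dot => h; rewrite !dot_hmul; apply: eq_dot => t.
  rewrite dot_hmul; apply: eq_dot => u.
  rewrite -dot_sum; apply: eq_dot => v.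
  exact: (starT_assoc _ _ _ (fun A => h (Node A))).
split.
  move=> x; split; apply: veq_dot => h; rewrite dot_hmul ?dot_bvec.
    by apply: eq_dot => -[F]; rewrite (starT_nill _ (fun A => h (Node A))).
  apply: eq_dot => -[F].
  by rewrite dot_bvec (starT_nilr _ (fun A => h (Node A))).
split.
  move=> x; apply: veq_dot => h.
  rewrite dot_coprod_l dot_coprod_r !dot_coprod; apply: eq_dot => t.
  exact: (fcop_coassoc _ (fun A B C => h (Node A, Node B, Node C))).
split.
  move=> x; split; apply: veq_dot => h; rewrite dot_flin dot_coprod;
      apply: eq_dot => -[F] /=.
    rewrite -[RHS](fcop_counitl F (fun A => h (Node A))).
    apply: eq_bigr => p _; rewrite dot_single eps_tE.
    by case: ifP; rewrite ?mul1r ?mul0r.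
  rewrite -[RHS](fcop_counitr F (fun A => h (Node A))).
  apply: eq_bigr => p _; rewrite dot_single eps_tE.
  by case: ifP; rewrite ?mul1r ?mul0r.
split.
  move=> x y; apply: veq_dot => h.
  rewrite dot_coprod dot_hmul dot_hmul2 dot_coprod; apply: eq_dot => t.
  under [RHS]eq_bigr do rewrite dot_coprod.
  rewrite -dot_sum; apply: eq_dot => u.
  exact: (fcop_starT _ _ (fun A B => h (Node A, Node B))).
split.
  by apply: veq_dot => h; rewrite dot_coprod !dot_bvec fcop_nil big_seq1.
split.
  move=> x y; rewrite -[LHS]/(dot _ _) dot_hmul -[eps x]/(dot _ _) -dot_mulr.
  apply: eq_dot => -[F]; rewrite -[eps y]/(dot _ _) -dot_mull.
  apply: eq_dot => -[G]; under eq_bigr do rewrite eps_tE.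
  rewrite starT_counit !eps_tE /=.
  by do 2![case: (_ == _)]; rewrite /= ?mul1r ?mul0r.
split; first by rewrite -[LHS]/(dot _ _) dot_bvec.
exists (antipode K) => x.
split; apply: veq_dot => h; rewrite dot_unitv_eps dot_flin dot_coprod;
    apply: eq_dot => -[F] /=.
  rewrite -[RHS](antidot_left F (fun A => h (Node A))).
  apply: eq_bigr => p _; rewrite dot_hmul; apply: eq_dot => t.
  by rewrite dot_bvec.
rewrite -[RHS](antidot_right F (fun A => h (Node A))).
by apply: eq_bigr => p _; rewrite dot_hmul dot_bvec.
Qed.
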